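(* Let $A,B$ be finite-dimensional quantum systems, $\mathcal{E}_{B|A}$ a quantum operation (CPTP map) from $A$ to $B$, $\rho_A$ a state of $A$ and $\epsilon\in[0,1]$. Then $$\chi_\epsilon(\mathcal{E}_{B|A},\rho_A)=D^{\mathrm{LC1}}_\epsilon\big(\mathcal{E}_{B|A}\rho_{\tilde AA}\,\big\|\,\rho_{\tilde A}\otimes\mathcal{E}_{B|A}\rho_A\big),$$ where $\mathrm{LC1}$ refers to tests implementable by local operations and one-way classical communication from the holder of $\tilde A$ (Alice) to the holder of $B$ (Bob).
   Context: Each system has a fixed orthonormal (''classical'') basis $\{|i\rangle\}$. Identity maps on other systems are omitted. For a state $\rho_A$, $\tilde A$ is a copy of $A$, $\Phi_{\tilde A A}:=\sum_{i,j}|i\rangle_{\tilde A}|i\rangle_A\langle j|_{\tilde A}\langle j|_A$, $\rho_{\tilde A A}:=\rho_A^{1/2}\Phi_{\tilde AA}\rho_A^{1/2}$, $\rho_{\tilde A}:=\mathrm{Tr}_A\,\rho_{\tilde AA}$. For a set of tests $\mathrm{T}$ (operators $0\le T\le\mathbb{1}$), the associated hypothesis-testing relative entropy is $D_\epsilon(\tau^{(0)}\|\tau^{(1)}):=-\log\min\{\mathrm{Tr}\,\tau^{(1)}T:\ T\in\mathrm{T},\ \mathrm{Tr}\,\tau^{(0)}T\ge1-\epsilon\}$, with $-\log 0=+\infty$. $D^{\mathrm{ALL}}_\epsilon$ uses all operators $0\le T\le\mathbb{1}$. $D^{\mathrm{LC1}}_\epsilon$, for the bipartition $\tilde A{:}B$,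 uses the convex hull of operators of the form $\sum_{a,b}T(a,b)E(a)_{\tilde A}\otimes D^a(b)_B$ with $\{E(a)_{\tilde A}\}_a$ a finite POVM on $\tilde A$, $\{D^a(b)_B\}_b$ a finite POVM on $B$ for each $a$, and $0\le T(a,b)\le1$. $\mathrm{Ens}(\rho_A)$ is the set of all states $\eta_{CA}=\sum_{k=1}^{\dim C}p_k|k\rangle\langle k|_C\otimes\rho(k)_A$ with $C$ some finite-dimensional system, $p_k\ge0$, $\sum_kp_k=1$, $\rho(k)_A$ states of $A$, and $\sum_kp_k\rho(k)_A=\rho_A$. With $\eta_C:=\mathrm{Tr}_A\eta_{CA}$, $$\chi_\epsilon(\mathcal{E}_{B|A},\rho_A):=\max_{\eta_{CA}\in\mathrm{Ens}(\rho_A)}D^{\mathrm{ALL}}_\epsilon(\mathcal{E}_{B|A}\eta_{CA}\,\|\,\eta_C\otimes\mathcal{E}_{B|A}\rho_A).$$ *)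

(* Defs.v *)
From mathcomp Require Import all_boot all_order all_algebra.
From mathcomp Require Import spectral.
From mathcomp Require Import complex mxtens.
From mathcomp Require Import all_classical all_reals all_analysis.

Set Implicit Arguments.
Unset Strict Implicit.
Unset Printing Implicit Defensive.

Import Order.TTheory GRing.Theory Num.Theory.

(* A system of dimension n is the index type 'I_n of its
   classical basis, operators are matrices over R[i], and the composite of
   systems of dimensions m and n is 'I_(m * n) through mxtens_index, so that
   the operator X (x) Y is the Kronecker product X *t Y of mxtens. *)

Local Open Scope classical_set_scope.
Local Open Scope ring_scope.
Local Open Scope complex_scope.
Local Open Scope sesquilinear_scope.

Section Operators.
Variable R : realType.
Local Notation C := R[i].

(* In R[i], 0 <= z means that z is real and nonnegative, so psdmx A also forces
   A to be Hermitian. *)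
Definition psdmx n (A : 'M[C]_n) : Prop :=
  forall v : 'cV[C]_n, 0 <= (v ^t* *m A *m v) 0 0.

Definition density n (A : 'M[C]_n) : Prop := psdmx A /\ \tr A = 1.

(* Spectral calculus; for psdmx A this is the positive square root of A. *)
Definition sqrtmx n (A : 'M[C]_n) : 'M[C]_n :=
  invmx (spectralmx A) *m diag_mx (map_mx sqrtC (spectral_diag A))
    *m spectralmx A.

(* Tr over the second factor. *)
Definition ptrace2 m n (X : 'M[C]_(m * n)) : 'M[C]_m :=
  \matrix_(i, j) \sum_k X (mxtens_index (i, k)) (mxtens_index (j, k)).

(* The block of X between |i> and |j>, i.e. (<i| (x) 1) X (|j> (x) 1). *)
Definition blockmx k n (X : 'M[C]_(k * n)) (i j : 'I_k) : 'M[C]_n :=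
  \matrix_(a, b) X (mxtens_index (i, a)) (mxtens_index (j, b)).

(* The map (id (x) E), with the identity on a k-dimensional first factor. *)
Definition idtens k n m (E : 'M[C]_n -> 'M[C]_m) (X : 'M[C]_(k * n)) :
    'M[C]_(k * m) :=
  \sum_(i < k) \sum_(j < k) delta_mx i j *t E (blockmx X i j).

Definition completely_positive n m (E : 'M[C]_n -> 'M[C]_m) : Prop :=
  forall k (X : 'M[C]_(k * n)), psdmx X -> psdmx (idtens E X).

Definition trace_preserving n m (E : 'M[C]_n -> 'M[C]_m) : Prop :=
  forall X, \tr (E X) = \tr X.

Definition quantum_operation n m (E : {linear 'M[C]_n -> 'M[C]_m}) : Prop :=
  completely_positive E /\ trace_preserving E.

Definition povm n k (M : 'I_k -> 'M[C]_n) : Prop :=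
  (forall a, psdmx (M a)) /\ \sum_a M a = 1%:M.

Definition Phi n : 'M[C]_(n * n) :=
  \sum_(i < n) \sum_(j < n) delta_mx i j *t delta_mx i j.

(* rho_{A~A}; the copy A~ is the first tensor factor. *)
Definition canonical_purification n (rho : 'M[C]_n) : 'M[C]_(n * n) :=
  ((1%:M : 'M[C]_n) *t sqrtmx rho) *m Phi n
    *m ((1%:M : 'M[C]_n) *t sqrtmx rho).

Definition convex_hull n (S : set 'M[C]_n) : set 'M[C]_n :=
  [set T | exists k (w : 'I_k -> R) (X : 'I_k -> 'M[C]_n),
     [/\ forall i, 0 <= w i, \sum_i w i = 1, forall i, S (X i)
       & T = \sum_i (w i)%:C *: X i]].

Definition tests_ALL n : set 'M[C]_n :=
  [set T | psdmx T /\ psdmx (1%:M - T)].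

(* The outcome alphabet 'I_l of Bob does not depend on a: POVMs with fewer
   outcomes are padded with zero operators. *)
Definition one_way_tests nA nB : set 'M[C]_(nA * nB) :=
  [set X | exists k l (M : 'I_k -> 'M[C]_nA) (D : 'I_k -> 'I_l -> 'M[C]_nB)
                  (T : 'I_k -> 'I_l -> R),
     [/\ povm M, forall a, povm (D a), forall a b, 0 <= T a b <= 1
       & X = \sum_a \sum_b (T a b)%:C *: (M a *t D a b)]].

Definition tests_LC1 nA nB : set 'M[C]_(nA * nB) :=
  convex_hull (@one_way_tests nA nB).

End Operators.

Section Entropies.
Variable R : realType.
Local Notation C := R[i].

Definition has_minimum (S : set R) : Prop := exists2 x, S x & lbound S x.

Definition has_maximum (S : set (\bar R)) : Prop := exists2 x, S x & ubound S x.

(* - log_b x; since lne 0 = -oo, the value at x = 0 is +oo when 1 < b. *)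
Definition neglog (b x : R) : \bar R :=
  ((- lne x%:E) * ((ln b)^-1)%:E)%E.

Definition prob n (tau T : 'M[C]_n) : R := complex.Re (\tr (tau *m T)).

Definition type2_errors n (TT : set 'M[C]_n) (eps : R) (tau0 tau1 : 'M[C]_n) :
    set R :=
  [set prob tau1 T | T in [set T | TT T /\ 1 - eps <= prob tau0 T]].

(* The infimum is the minimum of type2_errors as soon as
   has_minimum (type2_errors TT eps tau0 tau1) holds. *)
Definition hyp_test_entropy (b : R) n (TT : set 'M[C]_n) (eps : R)
    (tau0 tau1 : 'M[C]_n) : \bar R :=
  neglog b (inf (type2_errors TT eps tau0 tau1)).

Definition Ens n (rho : 'M[C]_n) k : set 'M[C]_(k * n) :=
  [set eta | exists (p : 'I_k -> R) (r : 'I_k -> 'M[C]_n),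
     [/\ forall i, 0 <= p i, \sum_i p i = 1, forall i, density (r i),
         \sum_i (p i)%:C *: r i = rho
       & eta = \sum_i (p i)%:C *: (delta_mx i i *t r i)]].

Definition chi_values (b : R) nA nB (E : 'M[C]_nA -> 'M[C]_nB)
    (rho : 'M[C]_nA) (eps : R) : set (\bar R) :=
  [set d | exists k (eta : 'M[C]_(k * nA)), Ens rho eta /\
     d = hyp_test_entropy b (@tests_ALL R (k * nB)) eps
           (idtens E eta) (ptrace2 eta *t E rho)].

(* The supremum is the maximum of chi_values as soon as
   has_maximum (chi_values b E rho eps) holds. *)
Definition chi (b : R) nA nB (E : 'M[C]_nA -> 'M[C]_nB) (rho : 'M[C]_nA)
    (eps : R) : \bar R :=
  ereal_sup (chi_values b E rho eps).

End Entropies.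

(* Main.v *)
Require Import Defs.
From mathcomp Require Import all_boot all_order all_algebra.
From mathcomp Require Import spectral.
From mathcomp Require Import complex mxtens.
From mathcomp Require Import all_classical all_reals all_analysis.
From mathcomp Require Import lra.

Set Implicit Arguments.
Unset Strict Implicit.
Unset Printing Implicit Defensive.

Import Order.TTheory GRing.Theory Num.Theory.
Import numFieldNormedType.Exports.
Local Open Scope classical_set_scope.
Local Open Scope complex_scope.
Local Open Scope sesquilinear_scope.
Local Open Scope ring_scope.

(* A POVM M on A~ turns rho_{A~A} into the conditional operators
   N a = rho^(1/2) (M a)^T rho^(1/2) on A, which are positive and sum to rho, and
   every such decomposition of rho arises in this way (for singular rho, through
   the pseudo-inverse of rho^(1/2) and the projection on the kernel of rho).  One-way
   tests are the operators sum_a M a (x) F a with F a arbitrary tests of Bob, and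
   this set is already convex.  Dually, on a classical-quantum state only the
   diagonal blocks F a of a test matter.  So both sides minimize
   sum_a tr (N a) tr (E rho F a) under sum_a tr (E (N a) F a) >= 1 - eps, the right
   hand side jointly over (N, F), the left hand side over F for each N.
   Minima exist because, by Caratheodory's theorem for cones, boundedly many
   outcomes a suffice, so that the minimization runs over a compact set. *)

(** * Positive matrices *)

Section PositiveMatrices.
Variable R : realType.
Local Notation C := R[i].

Lemma trmxC_mul m n p (A : 'M[C]_(m, n)) (B : 'M[C]_(n, p)) :
  (A *m B)^t* = B^t* *m A^t*.
Proof. by rewrite trmx_mul map_mxM. Qed.

Lemma trmxC_linear m n (c : C) (A B : 'M[C]_(m, n)) :
  (A + c *: B)^t* = A^t* + c^* *: B^t*.
Proof. by apply/matrixP => i j; rewrite !mxE rmorphD rmorphM. Qed.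

Lemma psdmx_congr m n (A : 'M[C]_n) (Q : 'M[C]_(n, m)) :
  psdmx A -> psdmx (Q^t* *m A *m Q).
Proof. by move=> Ap v; have := Ap (Q *m v); rewrite trmxC_mul !mulmxA. Qed.

Lemma psdmx0 n : psdmx (0 : 'M[C]_n).
Proof. by move=> v; rewrite mulmx0 mul0mx mxE. Qed.

Lemma psdmxD n (A B : 'M[C]_n) : psdmx A -> psdmx B -> psdmx (A + B).
Proof. by move=> Ap Bp v; rewrite mulmxDr mulmxDl mxE addr_ge0. Qed.

Lemma psdmxZ n (c : C) (A : 'M[C]_n) : 0 <= c -> psdmx A -> psdmx (c *: A).
Proof. by move=> c0 Ap v; rewrite -scalemxAr -scalemxAl mxE mulr_ge0. Qed.

Lemma psdmx_sum (I : finType) n (A : I -> 'M[C]_n) :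
  (forall i, psdmx (A i)) -> psdmx (\sum_i A i).
Proof.
move=> Ap; apply: (big_ind (@psdmx R n)); [exact: psdmx0| |by move=> i _].
by move=> A1 A2; exact: psdmxD.
Qed.

Lemma mxform_sum n (A : 'M[C]_n) (v : 'cV[C]_n) :
  (v^t* *m A *m v) 0 0 = \sum_i \sum_j (v i 0)^* * A i j * v j 0.
Proof.
rewrite mxE exchange_big /=; apply: eq_bigr => j _.
by rewrite mxE mulr_suml; apply: eq_bigr => i _; rewrite !mxE.
Qed.

Lemma psdmx_diag n (d : 'rV[C]_n) : (forall i, 0 <= d 0 i) -> psdmx (diag_mx d).
Proof.
move=> d0 v; rewrite mul_mx_diag mxE; apply: sumr_ge0 => i _.
by rewrite !mxE mulrAC mulr_ge0// mulrC mul_conjC_ge0.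
Qed.

Lemma psdmx1 n : psdmx (1%:M : 'M[C]_n).
Proof.
by rewrite -diag_const_mx; apply: psdmx_diag => i; rewrite mxE.
Qed.

Lemma psdmx_diag_ge0 n (A : 'M[C]_n) i : psdmx A -> 0 <= A i i.
Proof.
move=> /(_ (delta_mx i 0)); rewrite trmx_delta map_delta_mx.
by rewrite -rowE -colE !mxE.
Qed.

Lemma psdmx_trace_ge0 n (A : 'M[C]_n) : psdmx A -> 0 <= \tr A.
Proof. by move=> Ap; apply: sumr_ge0 => i _; exact: psdmx_diag_ge0. Qed.

(** The quadratic form at e_i + z e_j. The choices of [z] made below turn positivity into facts on
    single entries. *)
Lemma psdmx_pair_ge0 n (A : 'M[C]_n) i j (z : C) : psdmx A ->
  0 <= A i i + z * A i j + z^* * A j i + z * z^* * A j j.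
Proof.
move=> /(_ (delta_mx i 0 + z *: delta_mx j 0)).
rewrite trmxC_linear !trmx_delta !map_delta_mx.
rewrite !(mulmxDl, mulmxDr) -?scalemxAl -?scalemxAr -?scalemxAl -!rowE -!colE.
rewrite !mxE.
rewrite addrA (addrAC (A i i)).
by rewrite (mulrA z^*) (mulrC z^* z).
Qed.

(** The diagonal is real and the form is real at [z = 1] and [z = 'i]; the vanishing imaginary parts
    are two linear equations that determine [A j i] from [A i j]. *)
Lemma psdmx_conj n (A : 'M[C]_n) i j : psdmx A -> A j i = (A i j)^*.
Proof.
move=> Ap.
have r k : 0 <= A k k by exact: psdmx_diag_ge0.
have h1 := psdmx_pair_ge0 i j 1 Ap; have h2 := psdmx_pair_ge0 i j 'i Ap.
move: (r i) (r j) h1 h2; case: (A i i) => a a'; case: (A j j) => d d'.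
case: (A i j) => x x'; case: (A j i) => y y'.
rewrite !lecE /= => /andP[/eqP a0 _] /andP[/eqP d0 _].
move=> /andP[/eqP e1 _] /andP[/eqP e2 _]; apply/eqP; rewrite eq_complex /=.
by apply/andP; split; apply/eqP; lra.
Qed.

(** At [z = 1, -1, 'i, - 'i] the form is [A i i + A j j] plus or minus twice the real or imaginary
    part of [A i j]. *)
Lemma psdmx_entry_bound n (A : 'M[C]_n) (c : R) i j : psdmx A ->
  (forall k, complex.Re (A k k) <= c) ->
  (`|complex.Re (A i j)| <= c) && (`|complex.Im (A i j)| <= c).
Proof.
move=> Ap Ac; have := psdmx_conj i j Ap.
have h1 := psdmx_pair_ge0 i j 1 Ap; have h2 := psdmx_pair_ge0 i j 'i Ap.
have h3 := psdmx_pair_ge0 i j (-1) Ap; have h4 := psdmx_pair_ge0 i j (- 'i) Ap.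
move: (Ac i) (Ac j) h1 h2 h3 h4; case: (A i i) => a a'; case: (A j j) => d d'.
case: (A i j) => x x'; case: (A j i) => y y'.
rewrite !lecE /= => ac dc /andP[_ h1] /andP[_ h2] /andP[_ h3] /andP[_ h4].
move=> /eqP; rewrite eq_complex /= => /andP[/eqP ey /eqP ey'].
by rewrite !ler_norml; apply/andP; split; apply/andP; split; lra.
Qed.

Lemma psdmx_diag_eq0 n (A : 'M[C]_n) i j : psdmx A -> A i i = 0 -> A i j = 0.
Proof.
move=> Ap Aii; have := psdmx_conj i j Ap; have := psdmx_diag_ge0 j Ap.
case E: (A i j) => [x x']; case Ej: (A j j) => [d d'].
rewrite lecE /= => /andP[/eqP d'0 d0] Eji.
(* choosing z = t (A i j)^* with t real, the form is affine in t *)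
have h (t : R) : 0 <= d - t * (x ^+ 2 + x' ^+ 2).
  have := psdmx_pair_ge0 j i (- (t / 2)%:C * (x +i* x')) Ap.
  by rewrite Aii E Eji Ej lecE /= => /andP[_] h; lra.
apply/eqP; rewrite eq_complex /= -(sqrf_eq0 x) -(sqrf_eq0 x').
rewrite -paddr_eq0 ?sqr_ge0//; apply/negPn/negP => q0.
(* At this [t] the affine expression equals -1. *)
have := h ((d + 1) / (x ^+ 2 + x' ^+ 2)); rewrite divfK//; lra.
Qed.

End PositiveMatrices.

(** * Functional calculus of a positive matrix *)

Section SpectralCalculus.
Variables (R : realType) (n : nat) (rho : 'M[R[i]]_n).
Local Notation C := R[i].
Implicit Types (f g : C -> C) (N : 'M[C]_n).

(** The form of [N^T] at [v] is the form of [N] at the entrywise conjugate of [v]. *)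
Lemma psdmx_tr N : psdmx N -> psdmx N^T.
Proof.
move=> Np v; have := Np (map_mx Num.conj v); rewrite !mxform_sum exchange_big /=.
congr (0 <= _); apply: eq_bigr => i _; apply: eq_bigr => j _.
by rewrite !mxE conjCK mulrC (mulrC (v j 0)) mulrA.
Qed.

Lemma psdmx_trmxC N : psdmx N -> N^t* = N.
Proof. by move=> Np; apply/matrixP => i j; rewrite !mxE [RHS](psdmx_conj j i Np). Qed.

Hypothesis rho_psd : psdmx rho.

Let P := spectralmx rho.
Let d := spectral_diag rho.

(** Shaped like [sqrtmx], so that [sqrtmx rho] is [funmx sqrtC] by conversion. The square root, its
    pseudo-inverse and the kernel projection are all instances, and their relations reduce to
    identities between scalar functions. *)
Definition funmx f : 'M[C]_n := invmx P *m diag_mx (map_mx f d) *m P.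

Lemma invmx_spectralmx : invmx P = P^t*.
Proof. exact/invmx_unitary/spectral_unitarymx. Qed.

Lemma funmx_id : funmx id = rho.
Proof.
have rhoN : rho \is normalmx by apply/normalmxP; rewrite psdmx_trmxC.
by rewrite [RHS](orthomx_spectralP rhoN) /funmx map_mx_id.
Qed.

Lemma eq_funmx f g : f =1 g -> funmx f = funmx g.
Proof.
by move=> fg; have -> : f = g by apply/funext.
Qed.

Lemma funmxM f g : funmx f *m funmx g = funmx (fun x => f x * g x).
Proof.
rewrite /funmx (_ : map_mx (fun x => f x * g x) d =
    \row_j (map_mx f d 0 j * map_mx g d 0 j)).
  by rewrite -mulmx_diag !mulmxA mulmxK// spectral_unit.
by apply/rowP => i; rewrite !mxE.
Qed.

Lemma funmxC f g : funmx f *m funmx g = funmx g *m funmx f.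
Proof.
rewrite [LHS]funmxM [RHS]funmxM; apply: eq_funmx => x; exact: mulrC.
Qed.

Lemma funmxD f g : funmx f + funmx g = funmx (fun x => f x + g x).
Proof.
rewrite /funmx (_ : map_mx (fun x => f x + g x) d = map_mx f d + map_mx g d).
  by rewrite [diag_mx (_ + _)]linearD mulmxDr mulmxDl.
by apply/rowP => i; rewrite !mxE.
Qed.

Lemma funmx0 : funmx (fun=> 0) = 0.
Proof.
rewrite /funmx (_ : map_mx _ d = 0); last by apply/rowP => i; rewrite !mxE.
by rewrite linear0 mulmx0 mul0mx.
Qed.

Lemma funmx1 : funmx (fun=> 1) = 1%:M.
Proof.
rewrite /funmx (_ : map_mx _ d = const_mx 1); last by apply/rowP => i; rewrite !mxE.
by rewrite diag_const_mx mulmx1 mulVmx// spectral_unit.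
Qed.

(** The eigenvalues are the diagonal entries of [P *m rho *m P^t*], which is positive by
    congruence. *)
Lemma spectral_diag_ge0 i : 0 <= d 0 i.
Proof.
have := psdmx_diag_ge0 i (psdmx_congr (P^t*) rho_psd).
rewrite -funmx_id /funmx trmxCK -invmx_spectralmx !mulmxA.
by rewrite mulmxV ?spectral_unit// mul1mx mulmxK ?spectral_unit// !mxE eqxx.
Qed.

Lemma psdmx_funmx f : (forall x, 0 <= x -> 0 <= f x) -> psdmx (funmx f).
Proof.
move=> f0; rewrite /funmx invmx_spectralmx; apply: psdmx_congr.
by apply: psdmx_diag => i; rewrite mxE f0// spectral_diag_ge0.
Qed.

(** In the eigenbasis of [rho], a zero eigenvalue squeezes the corresponding diagonal entry of [N']
    between 0 and 0, and a zero diagonal entry of a positive matrix forces its whole column to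
    vanish. *)
Lemma funmx_ker N : psdmx N -> psdmx (rho - N) ->
  N *m funmx (fun x => (x == 0)%:R) = 0.
Proof.
move=> Np rNp; set N' := P *m N *m P^t*.
have N'p : psdmx N' by have := psdmx_congr (P^t*) Np; rewrite trmxCK.
have N'0 : N' *m diag_mx (map_mx (fun x : C => (x == 0)%:R) d) = 0.
  apply/matrixP => i j; rewrite mul_mx_diag [RHS]mxE [LHS]mxE [X in _ * X]mxE.
  have [dj0|_] := eqVneq (d 0 j) 0; last by rewrite mulr0.
  rewrite mulr1 (psdmx_conj j i N'p) (psdmx_diag_eq0 i N'p) ?conjC0//.
  have := psdmx_diag_ge0 j (psdmx_congr (P^t*) rNp).
  rewrite trmxCK mulmxBr mulmxBl -/N' -{1}funmx_id /funmx.
  rewrite !mulmxA mulmxV ?spectral_unit// mul1mx -invmx_spectralmx.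
  rewrite mulmxK ?spectral_unit//.
  rewrite map_mx_id//.
 rewrite [X in 0 <= X]mxE.
 rewrite [X in X + _]mxE [X in _ + X]mxE.
rewrite eqxx mulr1n dj0 sub0r oppr_ge0.
  by move=> le0; apply/eqP; rewrite eq_le le0 psdmx_diag_ge0.
have PP : P^t* *m P = 1%:M by rewrite -invmx_spectralmx mulVmx ?spectral_unit.
set D := diag_mx _ in N'0.
have -> : N *m funmx (fun x => (x == 0)%:R) = P^t* *m (N' *m D) *m P.
  rewrite -[N in LHS]mul1mx -PP /funmx invmx_spectralmx /N' !mulmxA.
  exact: erefl.
by rewrite N'0 mulmx0 mul0mx.
Qed.

Lemma sqrtmx_sqr : sqrtmx rho *m sqrtmx rho = rho.
Proof.
rewrite [sqrtmx rho](_ : _ = funmx sqrtC)// funmxM -[RHS]funmx_id.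
by apply: eq_funmx => x; rewrite -expr2 sqrtCK.
Qed.

Lemma psdmx_sqrtmx : psdmx (sqrtmx rho).
Proof. by apply: psdmx_funmx => x; rewrite sqrtC_ge0. Qed.

(* G is the pseudo-inverse of sqrtmx rho and Q the projection on its kernel; the
   multiple c of Q is what lets several such N complete to a POVM. *)
Lemma sqrtmx_pinv : exists G Q : 'M[C]_n,
  [/\ psdmx G, psdmx Q, G *m rho *m G + Q = 1%:M &
     forall N, psdmx N -> psdmx (rho - N) -> forall c : C,
       sqrtmx rho *m (G *m N *m G + c *: Q) *m sqrtmx rho = N].
Proof.
(* Inversion sends 0 to 0, so the first function gives the pseudo-inverse without a case
   distinction. *)
exists (funmx (fun x => (sqrtC x)^-1)), (funmx (fun x => (x == 0)%:R)).
set G := funmx _; set Q := funmx _; set S := sqrtmx rho.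
have SE : S = funmx sqrtC by [].
have cases x : sqrtC x * (sqrtC x)^-1 + (x == 0)%:R = 1 :> C.
  have [->|x0] := eqVneq x 0; first by rewrite sqrtC0 mul0r add0r.
  by rewrite addr0 divff// sqrtC_eq0.
have SG : S *m G + Q = 1%:M.
  by rewrite SE funmxM funmxD -funmx1; apply: eq_funmx => x; rewrite cases.
have GS : G *m S = S *m G.
  rewrite SE; exact: funmxC.
have Qp : psdmx Q by apply: psdmx_funmx => x _; rewrite ler0n.
have SQ : S *m Q = 0.
  rewrite SE funmxM -funmx0; apply: eq_funmx => x.
  by have [->|_] := eqVneq x 0; rewrite ?sqrtC0 ?mul0r ?mulr0.
have Gp : psdmx G by apply: psdmx_funmx => x x0; rewrite invr_ge0 sqrtC_ge0.
have SS : S *m S = rho by exact: sqrtmx_sqr.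
have NQ N : psdmx N -> psdmx (rho - N) -> N *m Q = 0 by exact: funmx_ker.
(* From here on the spectral form of [S], [G] and [Q] is forgotten: the rest is algebra with
   [S G = G S = 1 - Q], [S Q = 0] and [N Q = 0]. *)
move: SG GS SQ SS NQ Gp Qp; clear SE; clearbody G Q S => SG GS SQ SS NQ Gp Qp.
have SGE : S *m G = 1%:M - Q by rewrite -SG addrK.
split=> [||| N Np rNp c]; [exact: Gp|exact: Qp| |].
  have -> : G *m rho *m G = G *m S *m (S *m G) by rewrite -SS !mulmxA.
  rewrite GS [X in _ *m X]SGE mulmxBr mulmx1.
  by rewrite -[in X in _ - X]GS -mulmxA SQ mulmx0 subr0.
have QN : Q *m N = 0.
  rewrite -(psdmx_trmxC Qp) -(psdmx_trmxC Np) -trmxC_mul (NQ _ Np rNp).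
  by rewrite trmx0 map_mx0.
rewrite mulmxDr mulmxDl -scalemxAr SQ scaler0 mul0mx addr0 !mulmxA SGE.
rewrite -[_ *m G *m S]mulmxA GS SGE mulmxBl mul1mx QN subr0 mulmxBr mulmx1.
by rewrite (NQ _ Np rNp) subr0.
Qed.

End SpectralCalculus.

(** * Traces on composite systems *)

Section TensorAlgebra.
Variable R : realType.
Local Notation C := R[i].

Lemma mxtens_ext m n p q (A B : 'M[C]_(m * n, p * q)) :
  (forall i a j b, A (mxtens_index (i, a)) (mxtens_index (j, b)) =
                   B (mxtens_index (i, a)) (mxtens_index (j, b))) -> A = B.
Proof.
move=> AB; apply/matrixP => x y.
by case: (mxtens_indexP x) => i a; case: (mxtens_indexP y) => j b.
Qed.

Lemma sum_mxtens_index m n (F : 'I_(m * n) -> C) :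
  \sum_x F x = \sum_i \sum_a F (mxtens_index (i, a)).
Proof.
rewrite (reindex (@mxtens_index m n)) /=; last first.
  by exists (@mxtens_unindex m n) => x _; rewrite ?mxtens_indexK ?mxtens_unindexK.
by rewrite pair_bigA; apply: eq_bigr => -[i a].
Qed.

Lemma tensmx_sumr (I : finType) m n p q (A : 'M[C]_(m, n)) (c : I -> C)
    (B : I -> 'M[C]_(p, q)) :
  A *t (\sum_i c i *: B i) = \sum_i c i *: (A *t B i).
Proof.
apply: mxtens_ext => i a j b; rewrite tensmxE !summxE mulr_sumr.
by apply: eq_bigr => k _; rewrite !mxE !mxtens_indexK /= mulrCA.
Qed.

Lemma tensmx_suml (I : finType) m n p q (A : I -> 'M[C]_(m, n)) (c : I -> C)
    (B : 'M[C]_(p, q)) :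
  (\sum_i c i *: A i) *t B = \sum_i c i *: (A i *t B).
Proof.
apply: mxtens_ext => i a j b; rewrite tensmxE !summxE mulr_suml.
by apply: eq_bigr => k _; rewrite !mxE !mxtens_indexK /= mulrA.
Qed.

Lemma tensmxZl m n p q (c : C) (A : 'M[C]_(m, n)) (B : 'M[C]_(p, q)) :
  (c *: A) *t B = c *: (A *t B).
Proof.
by apply: mxtens_ext => i a j b; rewrite tensmxE !mxE !mxtens_indexK /= mulrA.
Qed.

Lemma tensmxZr m n p q (c : C) (A : 'M[C]_(m, n)) (B : 'M[C]_(p, q)) :
  A *t (c *: B) = c *: (A *t B).
Proof.
by apply: mxtens_ext => i a j b; rewrite tensmxE !mxE !mxtens_indexK /= mulrCA.
Qed.

Lemma mxtrace_tens m n (A : 'M[C]_m) (B : 'M[C]_n) : \tr (A *t B) = \tr A * \tr B.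
Proof.
rewrite /mxtrace sum_mxtens_index mulr_suml; apply: eq_bigr => i _.
by rewrite mulr_sumr; apply: eq_bigr => a _; rewrite tensmxE.
Qed.

Lemma mxtrace_delta_mul m (i j : 'I_m) (A : 'M[C]_m) :
  \tr (delta_mx i j *m A) = A j i.
Proof.
by rewrite -(mul_delta_mx (0 : 'I_1)) -mulmxA mxtrace_mulC -rowE -colE trace_mx11 !mxE.
Qed.

Lemma mxtrace_tens_delta k n (i j : 'I_k) (Y : 'M[C]_n) (T : 'M[C]_(k * n)) :
  \tr ((delta_mx i j *t Y) *m T) = \tr (Y *m blockmx T j i).
Proof.
rewrite /mxtrace sum_mxtens_index (bigD1 i)//= [X in _ + X]big1 ?addr0; last first.
  move=> i' i'i; rewrite big1// => a _; rewrite mxE sum_mxtens_index big1// => j' _.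
  by rewrite big1// => b _; rewrite tensmxE mxE (negbTE i'i) !mul0r.
apply: eq_bigr => a _; rewrite !mxE sum_mxtens_index (bigD1 j)//=.
rewrite [X in _ + X]big1 ?addr0; last first.
  by move=> j' j'j; rewrite big1// => b _; rewrite tensmxE mxE (negbTE j'j) andbF !mul0r.
by apply: eq_bigr => b _; rewrite tensmxE !mxE !eqxx mul1r.
Qed.

Lemma blockmx_sum k n (Y : 'I_k -> 'I_k -> 'M[C]_n) i j :
  blockmx (\sum_i \sum_j delta_mx i j *t Y i j) i j = Y i j.
Proof.
apply/matrixP => a b; rewrite mxE summxE (bigD1 i)//= summxE (bigD1 j)//=.
rewrite tensmxE mxE !eqxx mul1r [X in _ + X + _]big1 ?addr0; last first.
  by move=> j' j'j; rewrite tensmxE mxE (eq_sym j) (negbTE j'j) andbF mul0r.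
rewrite big1 ?addr0// => i' i'i; rewrite summxE big1// => j' _.
by rewrite tensmxE mxE eq_sym (negbTE i'i) mul0r.
Qed.

Lemma canonical_purificationE n (rho : 'M[C]_n) :
  canonical_purification rho =
  \sum_i \sum_j delta_mx i j *t (sqrtmx rho *m delta_mx i j *m sqrtmx rho).
Proof.
rewrite /canonical_purification /Phi mulmx_sumr mulmx_suml; apply: eq_bigr => i _.
rewrite mulmx_sumr mulmx_suml; apply: eq_bigr => j _.
by rewrite !tensmx_mul mul1mx mulmx1.
Qed.

(** With [S = sqrtmx rho], the block (i, j) of the purification is S |i><j| S, whose trace is the
    entry (j, i) of [S *m S = rho]. *)
Lemma ptrace2_purification n (rho : 'M[C]_n) : psdmx rho ->
  ptrace2 (canonical_purification rho) = rho^T.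
Proof.
move=> rhop; apply/matrixP => i j; rewrite mxE canonical_purificationE.
have -> (X : 'M[C]_(n * n)) : \sum_k X (mxtens_index (i, k)) (mxtens_index (j, k))
    = \tr (blockmx X i j) by apply: eq_bigr => k _; rewrite mxE.
by rewrite blockmx_sum mxtrace_mulC mulmxA sqrtmx_sqr// mxtrace_mulC mxtrace_delta_mul mxE.
Qed.

Variables (nA nB : nat) (E : {linear 'M[C]_nA -> 'M[C]_nB}).

(** The argument of [E] is the partial trace over the first factor of (M (x) 1) X, the unnormalized
    state left by the effect [M]. *)
Lemma trace_idtens k (X : 'M[C]_(k * nA)) (M : 'M[C]_k) (F : 'M[C]_nB) :
  \tr (idtens E X *m (M *t F)) =
  \tr (E (\sum_i \sum_j M j i *: blockmx X i j) *m F).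
Proof.
rewrite /idtens mulmx_suml !linear_sum /= mulmx_suml linear_sum /=.
apply: eq_bigr => i _; rewrite mulmx_suml !linear_sum /= mulmx_suml linear_sum /=.
apply: eq_bigr => j _; rewrite tensmx_mul mxtrace_tens mxtrace_delta_mul.
by rewrite linearZ /= -scalemxAl linearZ.
Qed.

(** Transpose trick: the effect [M] on the copy prepares [S *m M^T *m S] on A, with
    [S = sqrtmx rho]. This is how a POVM of Alice becomes a decomposition of [rho]. *)
Lemma trace_purification_test (rho : 'M[C]_nA) (M : 'M[C]_nA) (F : 'M[C]_nB) :
  \tr (idtens E (canonical_purification rho) *m (M *t F)) =
  \tr (E (sqrtmx rho *m M^T *m sqrtmx rho) *m F).
Proof.
rewrite trace_idtens; congr (\tr (E _ *m F)).
rewrite [in RHS](matrix_sum_delta M^T) mulmx_sumr mulmx_suml.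
apply: eq_bigr => i _; rewrite mulmx_sumr mulmx_suml; apply: eq_bigr => j _.
by rewrite canonical_purificationE blockmx_sum mxE -scalemxAr -scalemxAl.
Qed.

(** The same conditional operator governs the product state, since the trace of [rho^T *m M] equals
    that of [rho *m M^T]. *)
Lemma trace_marginal_test (rho : 'M[C]_nA) (M : 'M[C]_nA) (X F : 'M[C]_nB) :
  psdmx rho ->
  \tr ((ptrace2 (canonical_purification rho) *t X) *m (M *t F)) =
  \tr (sqrtmx rho *m M^T *m sqrtmx rho) * \tr (X *m F).
Proof.
move=> rhop; rewrite tensmx_mul mxtrace_tens ptrace2_purification//.
congr (_ * _); rewrite [RHS]mxtrace_mulC mulmxA sqrtmx_sqr//.
by rewrite -[LHS]mxtrace_tr trmx_mul trmxK mxtrace_mulC.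
Qed.

(* Classical-quantum states, with unnormalized conditional states N i. *)
Definition cqmx k n (N : 'I_k -> 'M[C]_n) : 'M[C]_(k * n) :=
  \sum_i delta_mx i i *t N i.

Lemma cqmx_blockE k n (N : 'I_k -> 'M[C]_n) i j :
  blockmx (cqmx N) i j = if i == j then N i else 0.
Proof.
apply/matrixP => a b; rewrite mxE summxE (bigD1 i)//= tensmxE mxE eqxx.
rewrite big1 ?addr0 => [|i' i'i]; last first.
  by rewrite tensmxE mxE eq_sym (negbTE i'i) mul0r.
by rewrite eq_sym; case: eqP; rewrite ?mul1r ?mul0r ?mxE.
Qed.

Lemma idtens_cqmx k (N : 'I_k -> 'M[C]_nA) :
  idtens E (cqmx N) = cqmx (fun i => E (N i)).
Proof.
apply: eq_bigr => i _; rewrite (bigD1 i)//= big1 ?addr0 => [|j ji].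
  by rewrite cqmx_blockE eqxx.
by rewrite cqmx_blockE eq_sym (negbTE ji) linear0 tensmx0.
Qed.

Lemma ptrace2_cqmx k n (N : 'I_k -> 'M[C]_n) :
  ptrace2 (cqmx N) = \sum_i \tr (N i) *: delta_mx i i.
Proof.
apply/matrixP => i j; rewrite mxE.
have -> (X : 'M[C]_(k * n)) : \sum_k X (mxtens_index (i, k)) (mxtens_index (j, k))
    = \tr (blockmx X i j) by apply: eq_bigr => l _; rewrite mxE.
rewrite cqmx_blockE summxE (bigD1 i)//= !mxE eqxx big1 ?addr0 => [|i' i'i].
  by rewrite eq_sym; case: eqP; rewrite ?mulr1 ?mulr0 ?mxtrace0.
by rewrite !mxE eq_sym (negbTE i'i) mulr0.
Qed.

Lemma trace_cqmx k n (N : 'I_k -> 'M[C]_n) (T : 'M[C]_(k * n)) :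
  \tr (cqmx N *m T) = \sum_i \tr (N i *m blockmx T i i).
Proof.
rewrite /cqmx mulmx_suml linear_sum; apply: eq_bigr => i _ /=.
exact: mxtrace_tens_delta.
Qed.

Lemma trace_cqmx_marginal k n (N : 'I_k -> 'M[C]_n) (X : 'M[C]_nB)
    (T : 'M[C]_(k * nB)) :
  \tr ((ptrace2 (cqmx N) *t X) *m T) =
  \sum_i \tr (N i) * \tr (X *m blockmx T i i).
Proof.
rewrite ptrace2_cqmx tensmx_suml mulmx_suml linear_sum; apply: eq_bigr => i _ /=.
by rewrite -scalemxAl linearZ /= mxtrace_tens_delta.
Qed.

Lemma cqmxE k n (N : 'I_k -> 'M[C]_n) i a j b :
  cqmx N (mxtens_index (i, a)) (mxtens_index (j, b)) =
  if i == j then N i a b else 0.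
Proof.
by have /matrixP/(_ a b) := cqmx_blockE N i j; rewrite mxE => ->; case: eqP; rewrite ?mxE.
Qed.

(** The form splits into the forms of the [N i] at the slices of the vector. *)
Lemma psdmx_cqmx k n (N : 'I_k -> 'M[C]_n) :
  (forall i, psdmx (N i)) -> psdmx (cqmx N).
Proof.
move=> Np v; rewrite mxform_sum sum_mxtens_index; apply: sumr_ge0 => i _.
have := Np i (\col_a v (mxtens_index (i, a)) 0); rewrite mxform_sum.
congr (0 <= _); apply: eq_bigr => a _; rewrite sum_mxtens_index (bigD1 i)//=.
rewrite [X in _ = _ + X]big1 ?addr0 => [|j ji]; last first.
  by rewrite big1// => b _; rewrite cqmxE eq_sym (negbTE ji) mulr0 mul0r.
by apply: eq_bigr => b _; rewrite cqmxE eqxx !mxE.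
Qed.

Lemma psdmx_blockmx k n (T : 'M[C]_(k * n)) i : psdmx T -> psdmx (blockmx T i i).
Proof.
(* [w] is |i> (x) v, so that the form of [T] at [w] is the form of the block at [v]. *)
move=> Tp v; pose w : 'cV[C]_(k * n) :=
  \col_x (((mxtens_unindex x).1 == i)%:R * v (mxtens_unindex x).2 0).
have wE j a : w (mxtens_index (j, a)) 0 = (j == i)%:R * v a 0.
  by rewrite mxE mxtens_indexK.
have := Tp w; rewrite !mxform_sum sum_mxtens_index (bigD1 i)//=.
rewrite [X in _ + X]big1 ?addr0 => [|j ji]; last first.
  by rewrite big1// => a _; rewrite big1// => x _; rewrite wE (negbTE ji) mul0r conjC0 !mul0r.
congr (0 <= _); apply: eq_bigr => a _; rewrite sum_mxtens_index (bigD1 i)//=.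
rewrite [X in _ + X]big1 ?addr0 => [|j ji]; last first.
  by rewrite big1// => b _; rewrite [X in _ * X]wE (negbTE ji) mul0r mulr0.
by apply: eq_bigr => b _; rewrite !wE eqxx !mul1r mxE.
Qed.

Lemma cqmxB1 k n (F : 'I_k -> 'M[C]_n) :
  1%:M - cqmx F = cqmx (fun i => 1%:M - F i).
Proof.
apply: mxtens_ext => i a j b; rewrite cqmxE !mxE cqmxE.
rewrite (can_eq (@mxtens_indexK _ _)) xpair_eqE.
by case: eqP => _ /=; rewrite ?subr0.
Qed.

Lemma blockmxB1 k n (T : 'M[C]_(k * n)) i :
  blockmx (1%:M - T) i i = 1%:M - blockmx T i i.
Proof.
apply/matrixP => a b; rewrite !mxE (can_eq (@mxtens_indexK _ _)) xpair_eqE.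
by rewrite eqxx.
Qed.

End TensorAlgebra.

(** * Attainable pairs of errors *)

Section ErrorSets.
Variable R : realType.
Local Notation C := R[i].

Lemma tests_ALL0 n : tests_ALL (0 : 'M[C]_n).
Proof. by split; [exact: psdmx0|rewrite subr0; exact: psdmx1]. Qed.

Lemma tests_ALL1 n : tests_ALL (1%:M : 'M[C]_n).
Proof. by split; [exact: psdmx1|rewrite subrr; exact: psdmx0]. Qed.

Lemma tests_ALL_cqmx k n (F : 'I_k -> 'M[C]_n) :
  (forall i, tests_ALL (F i)) -> tests_ALL (cqmx F).
Proof.
move=> Ft; split; first by apply: psdmx_cqmx => i; have [] := Ft i.
by rewrite cqmxB1; apply: psdmx_cqmx => i; have [] := Ft i.
Qed.

Lemma tests_ALL_blockmx k n (T : 'M[C]_(k * n)) i :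
  tests_ALL T -> tests_ALL (blockmx T i i).
Proof.
by move=> [Tp Tp']; split; rewrite -?blockmxB1; exact: psdmx_blockmx.
Qed.

(* The pairs (Y, X) form a convex cone; Y = 1 makes the M's a POVM, so that X is
   then an LC1 test (tests_LC1P). *)
Definition local_decomposition nA nB (Y : 'M[C]_nA) (X : 'M[C]_(nA * nB)) : Prop :=
  exists s : seq ('M[C]_nA * 'M[C]_nB),
    [/\ forall q, q \in s -> psdmx q.1 /\ tests_ALL q.2,
        Y = \sum_(q <- s) q.1 & X = \sum_(q <- s) q.1 *t q.2].

Lemma local_decompositionD nA nB (Y1 Y2 : 'M[C]_nA) (X1 X2 : 'M[C]_(nA * nB)) :
  local_decomposition Y1 X1 -> local_decomposition Y2 X2 ->
  local_decomposition (Y1 + Y2) (X1 + X2).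
Proof.
move=> [s1 [s1P -> ->]] [s2 [s2P -> ->]]; exists (s1 ++ s2).
by split=> [q||]; rewrite ?big_cat// mem_cat => /orP[/s1P|/s2P].
Qed.

Lemma local_decomposition1 nA nB (M : 'M[C]_nA) (F : 'M[C]_nB) :
  psdmx M -> tests_ALL F -> local_decomposition M (M *t F).
Proof.
move=> Mp Ft; exists [:: (M, F)]; split; [|by rewrite big_seq1|by rewrite big_seq1].
by move=> q; rewrite inE => /eqP ->; split; [exact: Mp|exact: Ft].
Qed.

Lemma local_decomposition_sum (I : finType) nA nB (Y : I -> 'M[C]_nA)
    (X : I -> 'M[C]_(nA * nB)) :
  (forall i, local_decomposition (Y i) (X i)) ->
  local_decomposition (\sum_i Y i) (\sum_i X i).
Proof.
move=> YX; apply: big_ind2; [|by move=> *; exact: local_decompositionD|by move=> i _].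
by exists [::]; split=> [q||]; rewrite ?big_nil.
Qed.

Lemma local_decompositionZ nA nB (c : C) (Y : 'M[C]_nA) (X : 'M[C]_(nA * nB)) :
  0 <= c -> local_decomposition Y X -> local_decomposition (c *: Y) (c *: X).
Proof.
move=> c0 [s [sP -> ->]]; exists [seq (c *: q.1, q.2) | q <- s].
split=> [q /mapP[q' /sP[q'p q't] ->]||].
- split; [exact: psdmxZ|exact: q't].
- by rewrite big_map scaler_sumr.
- by rewrite big_map scaler_sumr; apply: eq_bigr => q _; rewrite tensmxZl.
Qed.

Lemma prob_sum (I : finType) n (tau : 'M[C]_n) (X : I -> 'M[C]_n) :
  prob tau (\sum_i X i) = complex.Re (\sum_i \tr (tau *m X i)).
Proof. by rewrite /prob mulmx_sumr [\tr _]linear_sum. Qed.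

(** For each [a], Bob's POVM and the acceptance probabilities merge into the single test with terms
    [T a b] times [D a b]; its complement has the weights [1 - T a b]. *)
Lemma one_way_tests_decomposition nA nB (X : 'M[C]_(nA * nB)) :
  one_way_tests X -> local_decomposition 1%:M X.
Proof.
move=> [k [l [M [D [T [[Mp M1] Dp T01 ->]]]]]]; rewrite -M1.
apply: local_decomposition_sum => a; have [Dap Da1] := Dp a.
rewrite -tensmx_sumr; apply: local_decomposition1 (Mp a) _; split.
  apply: psdmx_sum => b; apply: psdmxZ (Dap b).
  by rewrite ler0c; case/andP: (T01 a b).
rewrite -Da1 -sumrB; apply: psdmx_sum => b.
rewrite -[X in X - _]scale1r -scalerBl; apply: psdmxZ (Dap b).
by rewrite subr_ge0 -[1]/(1%:C) lecR; case/andP: (T01 a b).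
Qed.

(** The convex hull adds nothing: mixing with weights [w i] amounts to one POVM of Alice whose
    effects are rescaled by [w i] and whose outcome also records [i]. *)
Lemma tests_LC1P nA nB (X : 'M[C]_(nA * nB)) :
  tests_LC1 X <-> local_decomposition 1%:M X.
Proof.
split=> [[k [w [Xs [w0 w1 Xst ->]]]]|[s [sP s1 ->]]].
  have -> : (1%:M : 'M[C]_nA) = \sum_i (w i)%:C *: 1%:M.
    by rewrite -scaler_suml -rmorph_sum w1 scale1r.
  apply: local_decomposition_sum => i; apply: local_decompositionZ.
    by rewrite ler0c.
  exact: one_way_tests_decomposition.
exists 1, (fun=> 1), (fun=> \sum_(q <- s) q.1 *t q.2); split=> //.
- by rewrite big_ord1.
- move=> _; pose q a := tnth (in_tuple s) a.
  (* Bob measures the two-outcome POVM made of the test and its complement, and accepts on outcome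
     [ord0]. *)
  exists (size s), 2, (fun a => (q a).1),
    (fun a b => if b == ord0 then (q a).2 else 1%:M - (q a).2),
    (fun a b => (b == ord0)%:R).
  have qP a := sP _ (mem_tnth a (in_tuple s)).
  split.
  + by split=> [a|]; [case: (qP a)|rewrite [RHS]s1 [RHS]big_tnth].
  + move=> a; split=> [b|]; last by rewrite big_ord_recl big_ord1/= subrKC.
    by have [_ [Fp Fp']] := qP a; case: (b == ord0); [exact: Fp|exact: Fp'].
  + by move=> a b; case: (b == ord0); rewrite ?ler01 ?lexx.
  + rewrite big_tnth; apply: eq_bigr => a _.
    by rewrite big_ord_recl big_ord1/= scale1r scale0r addr0.
- by rewrite big_ord1 scale1r.
Qed.

Variables (nA nB : nat) (E : {linear 'M[C]_nA -> 'M[C]_nB}) (rho : 'M[C]_nA).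
Variable eps : R.

(* alpha N F and beta N F are the values Tr tau0 T and Tr tau1 T of the test T
   described by F, both for cqmx N and for the purification. *)
Definition alpha k (N : 'I_k -> 'M[C]_nA) (F : 'I_k -> 'M[C]_nB) : R :=
  complex.Re (\sum_a \tr (E (N a) *m F a)).

Definition beta k (N : 'I_k -> 'M[C]_nA) (F : 'I_k -> 'M[C]_nB) : R :=
  complex.Re (\sum_a \tr (N a) * \tr (E rho *m F a)).

Definition decomposition k (N : 'I_k -> 'M[C]_nA) : Prop :=
  (forall a, psdmx (N a)) /\ \sum_a N a = rho.

Definition cq_errors k (N : 'I_k -> 'M[C]_nA) : set R :=
  [set beta N F | F in [set F | (forall a, tests_ALL (F a)) /\ 1 - eps <= alpha N F]].

Definition decomposition_errors : set R :=
  [set x | exists k (N : 'I_k -> 'M[C]_nA), decomposition N /\ cq_errors N x].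

(** Both traces see only the diagonal blocks of a test, and any family of tests [F a] is assembled
    into the block-diagonal test [cqmx F]. *)
Lemma type2_errors_cqmx k (N : 'I_k -> 'M[C]_nA) :
  type2_errors (@tests_ALL R (k * nB)) eps (idtens E (cqmx N))
    (ptrace2 (cqmx N) *t E rho) = cq_errors N.
Proof.
have aE T : prob (idtens E (cqmx N)) T = alpha N (fun a => blockmx T a a).
  by rewrite /prob idtens_cqmx trace_cqmx.
have bE T : prob (ptrace2 (cqmx N) *t E rho) T = beta N (fun a => blockmx T a a).
  by rewrite /prob trace_cqmx_marginal.
apply/seteqP; split=> x /=.
  move=> [T [Tt Ta] <-]; exists (fun a => blockmx T a a); last by rewrite bE.
  by split=> [a|]; [exact: tests_ALL_blockmx|rewrite -aE].
move=> [F [Ft Fa] <-].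
have FE : (fun a => blockmx (cqmx F) a a) = F.
  by apply/funext => a; rewrite cqmx_blockE eqxx.
exists (cqmx F); last by rewrite bE FE.
by split; [exact: tests_ALL_cqmx|rewrite aE FE].
Qed.

Lemma Ens_cqmx k (eta : 'M[C]_(k * nA)) : Ens rho eta ->
  exists2 N : 'I_k -> 'M[C]_nA, decomposition N & eta = cqmx N.
Proof.
move=> [p [r [p0 p1 rd rhoE ->]]]; exists (fun a => (p a)%:C *: r a).
  split=> // a; apply: psdmxZ; first by rewrite ler0c.
  by have [] := rd a.
by apply: eq_bigr => a _; rewrite tensmxZr.
Qed.

Lemma psdmx_tr0 n (A : 'M[C]_n) : psdmx A -> \tr A = 0 -> A = 0.
Proof.
move=> Ap /eqP; rewrite psumr_eq0 => [/allP A0|i _]; last exact: psdmx_diag_ge0.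
apply/matrixP => i j; rewrite [RHS]mxE; apply: psdmx_diag_eq0 => //.
by apply/eqP; apply: A0; rewrite mem_index_enum.
Qed.

Lemma cqmx_Ens k (N : 'I_k -> 'M[C]_nA) : density rho -> decomposition N ->
  Ens rho (cqmx N).
Proof.
move=> [rhop rho1] [Np Nrho].
have trE a : (complex.Re (\tr (N a)))%:C = \tr (N a).
  exact: RRe_real (ger0_real (psdmx_trace_ge0 (Np a))).
(* If the trace vanishes then [N a = 0] has probability 0 and any state can serve as conditional
   state; [rho] is one at hand. *)
have NE a : N a = (complex.Re (\tr (N a)))%:C *:
    (if \tr (N a) == 0 then rho else (\tr (N a))^-1 *: N a).
  rewrite trE; case: eqP => [t0|/eqP t0]; last by rewrite scalerA divff// scale1r.
  rewrite t0 scale0r; exact: (psdmx_tr0 (Np a) t0).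
exists (fun a => complex.Re (\tr (N a))),
  (fun a => if \tr (N a) == 0 then rho else (\tr (N a))^-1 *: N a); split.
- by move=> a; rewrite -ler0c trE; exact: psdmx_trace_ge0 (Np a).
- apply: (@complexI R); rewrite rmorph_sum /=.
  under eq_bigr do rewrite trE.
  by rewrite -linear_sum /= Nrho rho1.
- move=> a; case: eqP => [_|/eqP t0]; first by split.
  split; last by rewrite linearZ /= mulVf.
  apply: psdmxZ (Np a); rewrite invr_ge0; exact: psdmx_trace_ge0 (Np a).
- by under eq_bigr do rewrite -NE.
- by apply: eq_bigr => a _; rewrite {1}NE tensmxZr.
Qed.

Lemma psdmx_subr_sum (I : finType) n (A : I -> 'M[C]_n) i :
  (forall j, psdmx (A j)) -> psdmx (\sum_j A j - A i).
Proof.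
move=> Ap; rewrite (bigD1 i)//= addrAC subrr add0r.
by apply: (big_ind (@psdmx R n)); [exact: psdmx0|move=> *; exact: psdmxD|move=> j _].
Qed.

Lemma type2_errors_LC1 : density rho ->
  type2_errors (@tests_LC1 R nA nB) eps (idtens E (canonical_purification rho))
    (ptrace2 (canonical_purification rho) *t E rho) = decomposition_errors.
Proof.
move=> [rhop rho1]; apply/seteqP; split=> x.
  move=> [T [/tests_LC1P[s [sP s1 ->]] Ta] <-].
  pose q a := tnth (in_tuple s) a.
  pose N a := sqrtmx rho *m (q a).1^T *m sqrtmx rho.
  have qP a := sP _ (mem_tnth a (in_tuple s)).
  exists (size s), N; split.
    split=> [a|].
      rewrite /N -{1}(psdmx_trmxC (psdmx_sqrtmx rhop)); apply/psdmx_congr/psdmx_tr.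
      by case: (qP a).
    rewrite -mulmx_suml -mulmx_sumr -linear_sum /=.
    have -> : \sum_i (q i).1 = 1%:M by rewrite s1 [RHS]big_tnth.
    by rewrite trmx1 mulmx1 sqrtmx_sqr.
  exists (fun a => (q a).2).
    split=> [a|]; first by case: (qP a).
    rewrite (le_trans Ta)// big_tnth prob_sum.
    by under eq_bigr do rewrite trace_purification_test.
  rewrite [in RHS]big_tnth prob_sum.
  by under [in RHS]eq_bigr do rewrite trace_marginal_test//.
move=> [k [N [[Np Nrho] [F [Ft Fa] <-]]]].
have [G [Q [Gp Qp GQ SGS]]] := sqrtmx_pinv rhop.
(* The coefficients of [Q] are nonnegative and sum to [\tr rho = 1], so that the [M a] sum to the
   transpose of [G *m rho *m G + Q = 1%:M]. *)
pose M a := (G *m N a *m G + \tr (N a) *: Q)^T.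
have ME a : sqrtmx rho *m (M a)^T *m sqrtmx rho = N a.
  rewrite trmxK SGS; [by []|exact: Np|rewrite -Nrho; exact: psdmx_subr_sum Np].
have Mp a : psdmx (M a).
  apply: psdmx_tr; apply: psdmxD; last first.
    exact: psdmxZ (psdmx_trace_ge0 (Np a)) Qp.
  by have := psdmx_congr G (Np a); rewrite (psdmx_trmxC Gp).
have M1 : \sum_a M a = 1%:M.
  rewrite -linear_sum /= big_split /= -scaler_suml -mulmx_suml -mulmx_sumr.
  by rewrite -linear_sum /= Nrho rho1 scale1r GQ trmx1.
exists (\sum_a M a *t F a).
  split.
    apply/tests_LC1P; rewrite -M1; apply: local_decomposition_sum => a.
    exact: local_decomposition1 (Mp a) (Ft a).
  rewrite (le_trans Fa)// prob_sum.
  by under [X in _ <= complex.Re X]eq_bigr do rewrite trace_purification_test ME.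
rewrite prob_sum.
by congr complex.Re; apply: eq_bigr => a _; rewrite (trace_marginal_test _ _ _ rhop) ME.
Qed.

End ErrorSets.

(** * Bounding the number of outcomes *)

Section ConicCaratheodory.
Variable R : realType.

(** Elimination step of Caratheodory's theorem: [k.+1] vectors in dimension at most [k] satisfy a
    nontrivial relation [d]. Subtracting [d / d a0] from the all-ones weights, with [a0] maximizing
    [d], keeps them nonnegative and cancels the weight of [a0]. *)
Lemma conic_relation k (J : finType) (v : 'I_k.+1 -> J -> R) : (#|J| <= k)%N ->
  exists w : 'I_k.+1 -> R, exists a0, [/\ forall a, 0 <= w a, w a0 = 0 &
    forall j, \sum_a w a * v a j = \sum_a v a j].
Proof.
move=> Jk; pose V := \matrix_(a < k.+1, j < #|J|) v a (enum_val j).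
have /rowV0Pn[c /sub_kermxP cV c0] : kermx V != 0.
  rewrite kermx_eq0 /row_free neq_ltn (leq_trans _ (_ : (#|J| < k.+1)%N))//.
  by rewrite ltnS rank_leq_col.
(* Up to sign the relation has a positive entry, so its maximum is positive and can be divided
   by. *)
have [d dV [a1 da1]] : exists2 d : 'rV[R]_k.+1, d *m V = 0 & exists a, 0 < d 0 a.
  have [a ca] : exists a, c 0 a != 0.
    by apply/rV0Pn.
  case: (ltgtP (c 0 a) 0) ca => // [ca|ca] _; last by exists c => //; exists a.
  exists (- c); first by rewrite mulNmx cV oppr0.
  by exists a; rewrite mxE oppr_gt0.
pose a0 := [arg max_(a > a1) d 0 a]%O.
have [d0 dmax] : 0 < d 0 a0 /\ forall a, d 0 a <= d 0 a0.
  rewrite /a0; case: arg_maxP => // a _ amax.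
  by split=> [|b]; [exact: lt_le_trans da1 (amax _ _)|exact: amax].
exists (fun a => 1 - d 0 a / d 0 a0), a0; split=> [a||j].
- by rewrite subr_ge0 ler_pdivrMr// mul1r.
- by rewrite divff ?subrr// gt_eqF.
have : (d *m V) 0 (enum_rank j) = 0 by rewrite dV mxE.
rewrite mxE => dj; under eq_bigr do rewrite mulrBl mul1r.
rewrite sumrB [X in _ - X](_ : _ = 0) ?subr0//.
under eq_bigr do rewrite mulrAC.
rewrite -mulr_suml [X in X / _](_ : _ = 0) ?mul0r//.
by rewrite -[RHS]dj; apply: eq_bigr => a _; rewrite mxE enum_rankK.
Qed.

End ConicCaratheodory.

Section FewOutcomes.
Variables (R : realType) (nA nB : nat).
Local Notation C := R[i].
Variables (E : {linear 'M[C]_nA -> 'M[C]_nB}) (rho : 'M[C]_nA).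

Lemma Re_sum (I : finType) (F : I -> C) :
  complex.Re (\sum_i F i) = \sum_i complex.Re (F i).
Proof. by apply: (big_morph (@complex.Re R)) => // -[? ?] [? ?]. Qed.

Lemma Im_sum (I : finType) (F : I -> C) :
  complex.Im (\sum_i F i) = \sum_i complex.Im (F i).
Proof. by apply: (big_morph (@complex.Im R)) => // -[? ?] [? ?]. Qed.

Lemma ReZ (x : R) (z : C) : complex.Re (x%:C * z) = x * complex.Re z.
Proof. by case: z => a b /=; rewrite mul0r subr0. Qed.

Lemma ImZ (x : R) (z : C) : complex.Im (x%:C * z) = x * complex.Im z.
Proof. by case: z => a b /=; rewrite mul0r addr0. Qed.

(** Both values are prescribed exactly: reducing the number of outcomes must preserve [alpha] for
    the constraint and [beta] for the objective. *)
Definition attained k (x y : R) : Prop :=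
  exists (N : 'I_k -> 'M[C]_nA) (F : 'I_k -> 'M[C]_nB),
    [/\ decomposition rho N, forall a, tests_ALL (F a),
        alpha E N F = x & beta E rho N F = y].

Lemma attained_pad k x y : attained k x y -> attained k.+1 x y.
Proof.
move=> [N [F [[Np Nrho] Ft <- <-]]].
exists (fun a => oapp N 0 (unlift ord0 a)), (fun a => oapp F 0 (unlift ord0 a)).
split.
- split=> [a|]; first by case: unlift => [b|]; [exact: Np|exact: psdmx0].
  rewrite big_ord_recl unlift_none add0r -Nrho.
  by apply: eq_bigr => a _; rewrite liftK.
- by move=> a; case: unlift => [b|]; [exact: Ft|exact: tests_ALL0].
- rewrite /alpha big_ord_recl unlift_none /= mulmx0 mxtrace0 add0r.
  by congr complex.Re; apply: eq_bigr => a _; rewrite liftK.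
- rewrite /beta big_ord_recl unlift_none /= mxtrace0 mul0r add0r.
  by congr complex.Re; apply: eq_bigr => a _; rewrite liftK.
Qed.

(* Real coordinates of N a together with its contributions to alpha and beta. *)
Local Notation coords := (('I_nA * 'I_nA) * bool + bool)%type.

(** For fixed tests [F a], the sum of the [N a] and both error values are linear in [N]. The weights
    of [conic_relation] therefore preserve them, and the outcome of weight 0 is removed. *)
Lemma attained_drop k x y : (#|{: coords}| <= k)%N ->
  attained k.+1 x y -> attained k x y.
Proof.
move=> Jk [N [F [[Np Nrho] Ft <- <-]]].
pose v a (j : coords) : R := match j with
  | inl (ij, true) => complex.Re (N a ij.1 ij.2)
  | inl (ij, false) => complex.Im (N a ij.1 ij.2)
  | inr true => complex.Re (\tr (E (N a) *m F a))
  | inr false => complex.Re (\tr (N a) * \tr (E rho *m F a))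
  end.
have [w [a0 [w0 wa0 wv]]] := conic_relation v Jk.
exists (fun b => (w (lift a0 b))%:C *: N (lift a0 b)), (fun b => F (lift a0 b)).
have drop (f : 'I_k.+1 -> R) : \sum_b w (lift a0 b) * f (lift a0 b) = \sum_a w a * f a.
  by rewrite [RHS](bigD1_ord a0)//= wa0 mul0r add0r.
split.
- split=> [b|]; first by apply: psdmxZ (Np _); rewrite ler0c.
  rewrite -Nrho; apply/matrixP => i j; rewrite !summxE; apply/eqP.
  rewrite eq_complex; apply/andP; split; apply/eqP.
    rewrite !Re_sum -(wv (inl ((i, j), true))) -drop.
    by apply: eq_bigr => b _; rewrite mxE ReZ.
  rewrite !Im_sum -(wv (inl ((i, j), false))) -drop.
  by apply: eq_bigr => b _; rewrite mxE ImZ.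
- by move=> b; exact: Ft.
- rewrite /alpha !Re_sum -(wv (inr true)) -drop; apply: eq_bigr => b _.
  by rewrite linearZ /= -scalemxAl linearZ /= ReZ.
- rewrite /beta !Re_sum -(wv (inr false)) -drop; apply: eq_bigr => b _.
  by rewrite linearZ /= -mulrA ReZ.
Qed.

(** Padding raises a small number of outcomes and repeated elimination lowers a large one, so that
    all decompositions can be compared in one finite-dimensional space. *)
Lemma attained_bounded k x y : attained k x y -> attained #|{: coords}| x y.
Proof.
set d := #|_|; have [dk|/ltnW kd] := leqP d k; last first.
  rewrite -(subnKC kd); elim: (d - k)%N => [|m IH] h; first by rewrite addn0.
  by rewrite addnS; exact: attained_pad (IH h).
rewrite -(subnKC dk); elim: (k - d)%N => [|m IH]; first by rewrite addn0.
by rewrite addnS => /(attained_drop (leq_addr _ _)).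
Qed.

End FewOutcomes.

(** * Compactness *)

Section ComplexContinuity.
Variables (R : realType) (T : topologicalType).
Local Notation C := R[i].

(** Stated on real and imaginary parts, so that only the topology of [R] enters, as for the real
    cube used below. *)
Definition ccontinuous (g : T -> C) : Prop :=
  continuous (fun t => complex.Re (g t)) /\ continuous (fun t => complex.Im (g t)).

Lemma ccontinuous_cst (c : C) : ccontinuous (fun=> c).
Proof. by split; exact: cst_continuous. Qed.

Lemma ccontinuousD (f g : T -> C) :
  ccontinuous f -> ccontinuous g -> ccontinuous (fun t => f t + g t).
Proof.
move=> [fr fi] [gr gi]; split.
  rewrite (_ : (fun t => _) = (fun t => complex.Re (f t) + complex.Re (g t))).
    by move=> t; apply: cvgD; [exact: fr|exact: gr].
  by apply/funext => t; case: (f t) => ? ?; case: (g t).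
rewrite (_ : (fun t => _) = (fun t => complex.Im (f t) + complex.Im (g t))).
  by move=> t; apply: cvgD; [exact: fi|exact: gi].
by apply/funext => t; case: (f t) => ? ?; case: (g t).
Qed.

Lemma ccontinuousM (f g : T -> C) :
  ccontinuous f -> ccontinuous g -> ccontinuous (fun t => f t * g t).
Proof.
move=> [fr fi] [gr gi]; split.
  rewrite (_ : (fun t => _) = (fun t => complex.Re (f t) * complex.Re (g t) -
      complex.Im (f t) * complex.Im (g t))).
    move=> t; apply: cvgB; apply: cvgM;
      [exact: fr|exact: gr|exact: fi|exact: gi].
  by apply/funext => t; case: (f t) => ? ?; case: (g t).
rewrite (_ : (fun t => _) = (fun t => complex.Re (f t) * complex.Im (g t) +
    complex.Im (f t) * complex.Re (g t))).
  move=> t; apply: cvgD; apply: cvgM;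
    [exact: fr|exact: gi|exact: fi|exact: gr].
by apply/funext => t; case: (f t) => ? ?; case: (g t).
Qed.

Lemma ccontinuous_sum (I : finType) (f : I -> T -> C) :
  (forall i, ccontinuous (f i)) -> ccontinuous (fun t => \sum_i f i t).
Proof.
move=> fc; rewrite (_ : (fun t => _) = \sum_i f i); last first.
  by apply/funext => t; rewrite fct_sumE.
apply: (big_ind ccontinuous); [exact: ccontinuous_cst| |by move=> i _; exact: fc].
by move=> g h; exact: ccontinuousD.
Qed.

Definition mxcontinuous m n (A : T -> 'M[C]_(m, n)) : Prop :=
  forall i j, ccontinuous (fun t => A t i j).

Lemma mxcontinuous_cst m n (A : 'M[C]_(m, n)) : mxcontinuous (fun=> A).
Proof. by move=> i j; exact: ccontinuous_cst. Qed.

Lemma mxcontinuousM m n p (A : T -> 'M[C]_(m, n)) (B : T -> 'M[C]_(n, p)) :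
  mxcontinuous A -> mxcontinuous B -> mxcontinuous (fun t => A t *m B t).
Proof.
move=> Ac Bc i j; rewrite (_ : (fun t => _) = fun t => \sum_k A t i k * B t k j).
  by apply: ccontinuous_sum => k; apply: ccontinuousM.
by apply/funext => t; rewrite mxE.
Qed.

Lemma mxcontinuous_sum (I : finType) m n (A : I -> T -> 'M[C]_(m, n)) :
  (forall i, mxcontinuous (A i)) -> mxcontinuous (fun t => \sum_i A i t).
Proof.
move=> Ac i j; rewrite (_ : (fun t => _) = fun t => \sum_k A k t i j).
  by apply: ccontinuous_sum => k; exact: Ac.
by apply/funext => t; rewrite summxE.
Qed.

Lemma mxcontinuousB1 n (A : T -> 'M[C]_n) :
  mxcontinuous A -> mxcontinuous (fun t => 1%:M - A t).
Proof.
move=> Ac i j; rewrite (_ : (fun t => _) = fun t => 1%:M i j + (-1) * A t i j).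
  by apply: ccontinuousD; [exact: ccontinuous_cst|apply: ccontinuousM;
    [exact: ccontinuous_cst|exact: Ac]].
by apply/funext => t; rewrite [LHS]mxE [X in _ + X]mxE mulN1r.
Qed.

(** Expanding in matrix units, the entries of [E (A t)] are fixed linear combinations of those of
    [A t]. *)
Lemma mxcontinuous_linear m n (E : {linear 'M[C]_m -> 'M[C]_n}) (A : T -> 'M[C]_m) :
  mxcontinuous A -> mxcontinuous (fun t => E (A t)).
Proof.
move=> Ac i j; rewrite (_ : (fun t => _) =
  fun t => \sum_a \sum_b A t a b * E (delta_mx a b) i j).
  apply: ccontinuous_sum => a; apply: ccontinuous_sum => b.
  by apply: ccontinuousM; [exact: Ac|exact: ccontinuous_cst].
apply/funext => t; rewrite [in LHS](matrix_sum_delta (A t)) linear_sum summxE.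
apply: eq_bigr => a _; rewrite linear_sum summxE; apply: eq_bigr => b _.
by rewrite linearZ mxE.
Qed.

Lemma ccontinuous_trace n (A : T -> 'M[C]_n) :
  mxcontinuous A -> ccontinuous (fun t => \tr (A t)).
Proof. by move=> Ac; apply: ccontinuous_sum => i; exact: Ac. Qed.

Lemma closed_forall (I : Type) (P : I -> T -> Prop) :
  (forall i, closed [set t | P i t]) -> closed [set t | forall i, P i t].
Proof.
move=> Pc; rewrite (_ : [set t | _] = \bigcap_(i in setT) [set t | P i t]).
  by apply: closed_bigI => i _; exact: Pc.
by apply/seteqP; split=> t /= Pt i; [move=> _|]; exact: Pt.
Qed.

Lemma closed_comp_continuous (f : T -> R) (A : set R) :
  continuous f -> closed A -> closed [set t | A (f t)].
Proof. by move=> fc Ac; apply: (closed_comp _ Ac) => t _; exact: fc. Qed.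

Lemma closed_eqC (g : T -> C) (c : C) : ccontinuous g -> closed [set t | g t = c].
Proof.
move=> [gr gi]; rewrite (_ : [set t | _] =
  [set t | complex.Re (g t) = complex.Re c] `&`
  [set t | complex.Im (g t) = complex.Im c]).
  by apply: closedI; apply: (closed_comp_continuous (A := eq^~ _)) => //;
    exact: closed_eq.
apply/seteqP; split=> t /=; first by move=> ->.
by move=> [e1 e2]; apply/eqP; rewrite eq_complex e1 e2 !eqxx.
Qed.

Lemma closed_ge0C (g : T -> C) : ccontinuous g -> closed [set t | 0 <= g t].
Proof.
move=> [gr gi]; rewrite (_ : [set t | _] =
  [set t | complex.Im (g t) = 0] `&` [set t | 0 <= complex.Re (g t)]).
  apply: closedI; first exact: (closed_comp_continuous gi (@closed_eq _ _)).
  exact: (closed_comp_continuous gr (@closed_ge _ _)).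
apply/seteqP; split=> t /=; rewrite lecE /=.
  by move=> /andP[/eqP ? ?]; split.
by move=> [-> ->]; rewrite eqxx.
Qed.

Lemma closed_eqmx m n (A : T -> 'M[C]_(m, n)) (B : 'M[C]_(m, n)) :
  mxcontinuous A -> closed [set t | A t = B].
Proof.
move=> Ac; rewrite (_ : [set t | _] = [set t | forall i j, A t i j = B i j]).
  apply: closed_forall => i; apply: closed_forall => j; exact: closed_eqC.
apply/seteqP; split=> t /=; first by move=> ->.
by move=> AB; apply/matrixP.
Qed.

Lemma closed_psdmx n (A : T -> 'M[C]_n) :
  mxcontinuous A -> closed [set t | psdmx (A t)].
Proof.
move=> Ac; apply: closed_forall => v; apply: closed_ge0C.
apply: (mxcontinuousM (A := fun t => v^t* *m A t) (B := fun=> v)).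
  by apply: mxcontinuousM Ac; exact: mxcontinuous_cst.
exact: mxcontinuous_cst.
Qed.

Lemma closed_tests_ALL n (A : T -> 'M[C]_n) :
  mxcontinuous A -> closed [set t | tests_ALL (A t)].
Proof.
move=> Ac; apply: closedI; apply: closed_psdmx => //.
exact: mxcontinuousB1.
Qed.

End ComplexContinuity.

(** * Existence of minimal errors *)

Section Attainment.
Variables (R : realType) (nA nB : nat).
Local Notation C := R[i].
Variables (E : {linear 'M[C]_nA -> 'M[C]_nB}) (rho : 'M[C]_nA).

(** Tychonoff's theorem makes the cube of side [-1, 1] compact for pointwise convergence, hence also
    its closed subset [K], to which the extreme value theorem applies. *)
Lemma cube_minimum (J : choiceType) (K : set {ptws J -> R}) (f : {ptws J -> R} -> R) :
  K !=set0 -> closed K -> (forall t, K t -> forall j, -1 <= t j <= 1) ->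
  continuous f -> exists2 t, K t & forall u, K u -> f t <= f u.
Proof.
move=> K0 Kc Kb fc.
have Kco : compact K.
  have := @tychonoff J (fun=> R) (fun=> `[-1, 1]%classic)
    (fun=> @segment_compact _ _ _).
  move=> /(subclosed_compact Kc); apply => t Kt j /=.
  by rewrite in_itv /=; exact: Kb.
have [t] := compact_EVT_min K0 Kco (continuous_subspaceT (A := K) fc).
rewrite inE => Kt tmin; exists t => // u Ku; apply: tmin.
by rewrite inE.
Qed.

(** A diagonal entry of [N a] is at most [\tr rho = 1], since that trace is the sum of the
    nonnegative diagonal entries of all the pieces. *)
Lemma density_decomposition_bound k (N : 'I_k -> 'M[C]_nA) a i j :
  density rho -> decomposition rho N ->
  (`|complex.Re (N a i j)| <= 1) && (`|complex.Im (N a i j)| <= 1).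
Proof.
move=> [rhop rho1] [Np Nrho]; apply: psdmx_entry_bound (Np a) _ => l.
have le1 : N a l l <= 1.
  rewrite -rho1 -Nrho linear_sum /= (bigD1 a)//= /mxtrace (bigD1 l)//= -addrA.
  rewrite lerDl addr_ge0//; apply: sumr_ge0 => b _.
    exact: psdmx_diag_ge0 (Np a).
  exact: psdmx_trace_ge0 (Np b).
by move: le1; rewrite lecE => /andP[].
Qed.

Lemma tests_ALL_bound n (F : 'M[C]_n) i j : tests_ALL F ->
  (`|complex.Re (F i j)| <= 1) && (`|complex.Im (F i j)| <= 1).
Proof.
move=> [Fp Fp']; apply: psdmx_entry_bound Fp _ => l.
have := psdmx_diag_ge0 l Fp'; rewrite mxE [X in X + _]mxE eqxx [X in _ + X]mxE.
by rewrite subr_ge0 lecE => /andP[].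
Qed.

(* The boolean b freezes the decomposition to N0, so that the minima for a fixed
   and for a variable decomposition are two instances of one lemma. *)
Definition constrained_errors (eps : R) k (b : bool) (N0 : 'I_k -> 'M[C]_nA) : set R :=
  [set x | exists (N : 'I_k -> 'M[C]_nA) (F : 'I_k -> 'M[C]_nB),
    [/\ decomposition rho N, b -> N = N0, forall a, tests_ALL (F a),
        1 - eps <= alpha E N F & beta E rho N F = x]].

Local Notation coords k :=
  (('I_k * ('I_nA * 'I_nA) + 'I_k * ('I_nB * 'I_nB)) * bool)%type.

Lemma constrained_errors_minimum eps k b N0 : density rho ->
  @constrained_errors eps k b N0 !=set0 ->
  has_minimum (@constrained_errors eps k b N0).
Proof.
move=> rhod [x0 [N1 [F1 [N1d N1b F1t F1a _]]]].
pose Nt (t : {ptws coords k -> R}) a : 'M[C]_nA :=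
  \matrix_(i, j) (t (inl (a, (i, j)), true) +i* t (inl (a, (i, j)), false)).
pose Ft (t : {ptws coords k -> R}) a : 'M[C]_nB :=
  \matrix_(i, j) (t (inr (a, (i, j)), true) +i* t (inr (a, (i, j)), false)).
(* [enc] is a right inverse of the decodings [Nt] and [Ft]. *)
pose enc (N : 'I_k -> 'M[C]_nA) (F : 'I_k -> 'M[C]_nB) : {ptws coords k -> R} :=
  fun c => match c with
  | (inl (a, (i, j)), true) => complex.Re (N a i j)
  | (inl (a, (i, j)), false) => complex.Im (N a i j)
  | (inr (a, (i, j)), true) => complex.Re (F a i j)
  | (inr (a, (i, j)), false) => complex.Im (F a i j)
  end.
have Nenc N F : Nt (enc N F) = N.
  by apply/funext => a; apply/matrixP => i j; rewrite mxE /=; case: (N a i j).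
have Fenc N F : Ft (enc N F) = F.
  by apply/funext => a; apply/matrixP => i j; rewrite mxE /=; case: (F a i j).
have projc (c : coords k) : continuous (fun t : {ptws coords k -> R} => t c).
  exact: (@proj_continuous (coords k) (fun=> R) c).
have Nc a : mxcontinuous (Nt^~ a).
  move=> i j; split.
    rewrite (_ : (fun t => _) = (fun t : {ptws coords k -> R} => t (inl (a, (i, j)), true))).
      exact: projc.
    by apply/funext => t; rewrite mxE.
  rewrite (_ : (fun t => _) = (fun t : {ptws coords k -> R} => t (inl (a, (i, j)), false))).
    exact: projc.
  by apply/funext => t; rewrite mxE.
have Fc a : mxcontinuous (Ft^~ a).
  move=> i j; split.
    rewrite (_ : (fun t => _) = (fun t : {ptws coords k -> R} => t (inr (a, (i, j)), true))).
      exact: projc.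
    by apply/funext => t; rewrite mxE.
  rewrite (_ : (fun t => _) = (fun t : {ptws coords k -> R} => t (inr (a, (i, j)), false))).
    exact: projc.
  by apply/funext => t; rewrite mxE.
have alphac : continuous (fun t => alpha E (Nt t) (Ft t)).
  apply: (proj1 (ccontinuous_sum _)) => a; apply: ccontinuous_trace.
  by apply: mxcontinuousM (Fc a); exact: mxcontinuous_linear.
have betac : continuous (fun t => beta E rho (Nt t) (Ft t)).
  apply: (proj1 (ccontinuous_sum _)) => a.
  apply: ccontinuousM; apply: ccontinuous_trace; first exact: Nc.
  by apply: mxcontinuousM (Fc a); exact: mxcontinuous_cst.
pose K : set {ptws coords k -> R} :=
  [set t | [/\ decomposition rho (Nt t), b -> Nt t = N0,
     forall a, tests_ALL (Ft t a) & 1 - eps <= alpha E (Nt t) (Ft t)]].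
have Kclosed : closed K.
  have -> : K = [set t | forall a, psdmx (Nt t a)] `&`
     [set t | \sum_a Nt t a = rho] `&` [set t | b -> forall a, Nt t a = N0 a] `&`
     [set t | forall a, tests_ALL (Ft t a)] `&`
     [set t | 1 - eps <= alpha E (Nt t) (Ft t)].
    apply/seteqP; split=> t /=.
      by move=> [[? ?] Nb ? ?]; do !split=> //; move=> /Nb ->.
    by move=> [[[[? ?] Nb] ?] ?]; split=> // /Nb ?; apply/funext.
  do !apply: closedI.
  - by apply: closed_forall => a; exact: closed_psdmx.
  - by apply: closed_eqmx; exact: mxcontinuous_sum.
  (* The implication from [b] is treated as a family of conditions indexed by the proofs of [b]. *)
  - apply: closed_forall => _; apply: closed_forall => a; exact: closed_eqmx.
  - by apply: closed_forall => a; exact: closed_tests_ALL.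
  - exact: (closed_comp_continuous alphac (@closed_ge _ _)).
have Kbounded t : K t -> forall c, -1 <= t c <= 1.
  move=> [Nd _ Ftt _] [[[a [i j]]|[a [i j]]] []]; rewrite -ler_norml.
  - by have /andP[] := density_decomposition_bound a i j rhod Nd; rewrite mxE.
  - by have /andP[] := density_decomposition_bound a i j rhod Nd; rewrite !mxE.
  - by have /andP[] := tests_ALL_bound i j (Ftt a); rewrite mxE.
  - by have /andP[] := tests_ALL_bound i j (Ftt a); rewrite !mxE.
have K0 : K !=set0 by exists (enc N1 F1); rewrite /K /= Nenc Fenc; split.
have [t [Nd Nb Ftt ta] tmin] := cube_minimum K0 Kclosed Kbounded betac.
exists (beta E rho (Nt t) (Ft t)); first by exists (Nt t), (Ft t).
move=> _ [N [F [Nd' Nb' Ftt' Fa' <-]]].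
by have := tmin (enc N F); rewrite /K /= Nenc Fenc; apply; split.
Qed.

End Attainment.

(** * Monotonicity of the logarithm and attained extrema *)

Section Entropy.
Variable R : realType.

Lemma le_neglog (b x y : R) : 1 < b -> x <= y -> (neglog b y <= neglog b x)%E.
Proof.
move=> b1 xy; apply: lee_wpmul2r; first by rewrite lee_fin invr_ge0 ltW// ln_gt0.
(* [lne] takes the value [-oo] on nonpositive arguments. *)
rewrite leeN2; have [x0|x0] := leP x 0; first by rewrite le0_lneNy ?lee_fin// leNye.
by rewrite lee_lne ?lee_fin// in_itv/= leey lee_fin ltW// (lt_le_trans x0).
Qed.

Lemma inf_minimum (S : set R) x : S x -> lbound S x -> inf S = x.
Proof.
move=> Sx xS; apply/eqP; rewrite eq_le lb_le_inf ?andbT//; last by exists x.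
by apply: ge_inf => //; exists x.
Qed.

Lemma ereal_sup_maximum (S : set (\bar R)) x : S x -> ubound S x -> ereal_sup S = x.
Proof.
move=> Sx xS; apply/eqP; rewrite eq_le ereal_sup_ubound// andbT.
exact: ge_ereal_sup.
Qed.

End Entropy.

(** * Minima for a fixed and for a variable decomposition *)

Section ErrorMinima.
Variables (R : realType) (nA nB : nat).
Local Notation C := R[i].
Variables (E : {linear 'M[C]_nA -> 'M[C]_nB}) (rho : 'M[C]_nA) (eps : R).
Hypothesis E_tp : trace_preserving E.
Hypothesis rhod : density rho.
Hypothesis eps_ge0 : 0 <= eps.

Lemma cq_errors_neq0 k (N : 'I_k -> 'M[C]_nA) :
  decomposition rho N -> cq_errors E rho eps N !=set0.
Proof.
(* The test that always accepts is feasible: its [alpha] is [\tr rho = 1] because [E] preserves the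
   trace. *)
move=> [Np Nrho]; exists (beta E rho N (fun=> 1%:M)), (fun=> 1%:M) => //.
split=> [a|]; first exact: tests_ALL1.
rewrite /alpha; under eq_bigr do rewrite mulmx1 E_tp.
by rewrite -linear_sum /= Nrho rhod.2 /= gerBl.
Qed.

Lemma cq_errors_minimum k (N : 'I_k -> 'M[C]_nA) :
  decomposition rho N -> has_minimum (cq_errors E rho eps N).
Proof.
move=> Nd; have NE : cq_errors E rho eps N = constrained_errors E rho eps true N.
  apply/seteqP; split=> x.
    by move=> [F [Ft Fa] <-]; exists N, F; split.
  by move=> [N' [F [_ /(_ isT) -> Ft Fa <-]]]; exists F.
rewrite NE; apply: constrained_errors_minimum => //.
by rewrite -NE; exact: cq_errors_neq0.
Qed.

Lemma decomposition_errors_minimum :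
  has_minimum (decomposition_errors E rho eps).
Proof.
pose d := #|{: ('I_nA * 'I_nA) * bool + bool}|.
(* The flag [false] leaves the decomposition free, and [d] outcomes suffice by
   [attained_bounded]. *)
have dE : decomposition_errors E rho eps =
    constrained_errors E rho eps false (fun _ : 'I_d => 0).
  apply/seteqP; split=> x.
    move=> [k [N [Nd [F [Ft Fa] <-]]]].
    have /attained_bounded[N' [F' [Nd' Ft' aE bE]]] :
      attained E rho k (alpha E N F) (beta E rho N F) by exists N, F.
    by exists N', F'; split=> //; rewrite aE.
  by move=> [N [F [Nd _ Ft Fa <-]]]; exists d, N; split=> //; exists F.
rewrite dE; apply: constrained_errors_minimum => //; rewrite -dE.
(* Nonemptiness comes from the decomposition of [rho] into a single piece. *)
have rhoD : decomposition rho (fun _ : 'I_1 => rho).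
  by split=> [_|]; [exact: rhod.1|rewrite big_ord1].
by have [x xE] := cq_errors_neq0 rhoD; exists x, 1, (fun=> rho).
Qed.

End ErrorMinima.

Theorem proposition28 (R : realType) (b : R) (nA nB : nat)
    (E : {linear 'M[R[i]]_nA -> 'M[R[i]]_nB}) (rho : 'M[R[i]]_nA) (eps : R)
    (hb : 1 < b) (hE : quantum_operation E) (hrho : density rho)
    (heps : 0 <= eps <= 1) :
  let rhoAA := canonical_purification rho in
  let tau0 := idtens E rhoAA in
  let tau1 := ptrace2 rhoAA *t E rho in
  [/\ forall (k : nat) (eta : 'M[R[i]]_(k * nA)), Ens rho eta ->
        has_minimum (type2_errors (@tests_ALL R (k * nB)) eps
                       (idtens E eta) (ptrace2 eta *t E rho)),
      has_minimum (type2_errors (@tests_LC1 R nA nB) eps tau0 tau1),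
      has_maximum (chi_values b E rho eps)
    & chi b E rho eps
        = hyp_test_entropy b (@tests_LC1 R nA nB) eps tau0 tau1].
Proof.
move=> rhoAA tau0 tau1; have /andP[eps0 _] := heps; have [_ Etp] := hE.
have LC1E := type2_errors_LC1 E eps hrho.
rewrite -/rhoAA -/tau0 -/tau1 in LC1E.
have cqmin k (N : 'I_k -> 'M[R[i]]_nA) (Nd : decomposition rho N) :=
  cq_errors_minimum Etp hrho eps0 Nd.
(* [x] is the least error over all pairs (N, F); the [N] that reaches it yields an optimal
   ensemble. *)
have [x [k [N [Nd Nx]]] xmin] := decomposition_errors_minimum Etp hrho eps0.
have chix : chi_values b E rho eps (neglog b x).
  exists k, (cqmx N); split; first exact: cqmx_Ens.
  (* The errors for this [N] are among all [decomposition_errors], so [x] is their minimum as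
     well. *)
  rewrite /hyp_test_entropy type2_errors_cqmx (inf_minimum Nx)// => y Ny.
  by apply: xmin; exists k, N.
have xchi : ubound (chi_values b E rho eps) (neglog b x).
  move=> _ [l [eta [/Ens_cqmx[N' Nd' ->] ->]]].
  (* The minimum [y] of any other ensemble is at least [x], and [neglog] reverses the order. *)
  have [y N'y ymin] := cqmin _ _ Nd'.
  rewrite /hyp_test_entropy type2_errors_cqmx (inf_minimum N'y ymin).
  by apply: le_neglog => //; apply: xmin; exists l, N'.
split.
- move=> l eta /Ens_cqmx[N' Nd' ->]; rewrite type2_errors_cqmx; exact: cqmin.
- by rewrite LC1E; exists x => //; exists k, N.
- by exists (neglog b x).
rewrite /chi (ereal_sup_maximum chix xchi) /hyp_test_entropy LC1E.
by rewrite (inf_minimum _ xmin)//; exists k, N.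
Qed.
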